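(* Let $f:\Omega\to\mathbb H^3_1$ be a timelike immersion of a domain $\Omega\subset\mathbb R^2$ whose coordinates $(x,y)$ are null for the first fundamental form, with adapted frame $F:\Omega\to SL(2,\mathbb R)$ and Gauss map $\nu=\mathrm{Ad}_Fe_3$. Write $F^{-1}F_x=A^1\xi_1+A^2\xi_2+A^3e_3$, $F^{-1}F_y=B^1\xi_1+B^2\xi_2+B^3e_3$, and for $\lambda\in\mathbb R\setminus\{0\}$ let $$U^\lambda=A^1\lambda\,\xi_1+A^2\xi_2+A^3e_3,\qquad V^\lambda=B^1\xi_1+B^2\lambda^{-1}\xi_2+B^3e_3,\qquad \alpha^\lambda=U^\lambda\,dx+V^\lambda\,dy.$$ The following are equivalent: (1) $\nu$ is harmonic with respect to the conformal structure of the first fundamental form, that is $[\nu,\nu_{xy}]=0$; (2) the mean curvature $H$ of $f$ is constant; (3) $\alpha^\lambda$ satisfies the Maurer–Cartan equation $d\alpha^\lambda+\tfrac12[\alpha^\lambda,\alpha^\lambda]=0$ for every $\lambda$.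
   Context: Ambient space. On the space $\mathfrak{gl}(2,\mathbb R)$ of real $2\times2$ matrices let $\langle X,Y\rangle=-\tfrac12\operatorname{tr}(X\bar Y)$, where $\bar Y=(\operatorname{tr}Y)\mathrm{Id}-Y$; then $\langle X,X\rangle=-\det X$. Anti-de Sitter 3-space is $\mathbb H^3_1=\{X:\langle X,X\rangle=-1\}=SL(2,\mathbb R)$ with the induced Lorentzian metric. On $\mathfrak{sl}(2,\mathbb R)$, $\langle X,Y\rangle=\tfrac12\operatorname{tr}(XY)$. Put $e_3=\begin{pmatrix}-1&0\\0&1\end{pmatrix}$, $\xi_1=\begin{pmatrix}0&0\\1&0\end{pmatrix}$, $\xi_2=\begin{pmatrix}0&1\\0&0\end{pmatrix}$, $\mathrm{Ad}_FX=FXF^{-1}$. All maps are smooth; a domain is a connected open set. An immersion $f:\Omega\to\mathbb H^3_1$ is timelike if the induced metric is Lorentzian. Let $N$ be a unit normal ($\langle N,N\rangle=1$, $N$ orthogonal to $f,f_x,f_y$); the Gauss map is $\nu=f^{-1}N$, with values in $\mathbb S^2_1=\{X\in\mathfrak{sl}(2,\mathbb R):\langle X,X\rangle=1\}$. That $(x,y)$ are null for the first fundamental form means $\langle f_x,f_x\rangle=\langle f_y,f_y\rangle=0$ and $2\langle f_x,f_y\rangle=\varepsilon e^{\omega}$ with $\varepsilon=\pm1$ and $\omega$ a function. The mean curvature is $H=2\varepsilon e^{-\omega}\langle f_{xy},N\rangle$ (equivalently $H=-\tfrac12\operatorname{tr}S$ with $S$ the shape operator defined by $S(f_x,f_y)^T=(N_x,N_y)^T$).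 An adapted frame is a map $F:\Omega\to SL(2,\mathbb R)$ such that, for signs $\varepsilon_1,\varepsilon_2\in\{\pm1\}$ with $\varepsilon_1\varepsilon_2=\varepsilon$, $$f^{-1}f_x=\varepsilon_1e^{\omega/2}\mathrm{Ad}_F\xi_1,\qquad f^{-1}f_y=\varepsilon_2e^{\omega/2}\mathrm{Ad}_F\xi_2,\qquad N=f\,\mathrm{Ad}_Fe_3.$$ For $\alpha=U\,dx+V\,dy$ the Maurer–Cartan equation is equivalent to $U_y-V_x=[U,V]$. *)

(* Defs.v *)
From mathcomp Require Import all_boot all_order all_algebra.
From mathcomp Require Import all_classical all_reals all_analysis.

Set Implicit Arguments.
Unset Strict Implicit.
Unset Printing Implicit Defensive.

Import Order.TTheory GRing.Theory Num.Theory.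
Import numFieldNormedType.Exports.

Local Open Scope classical_set_scope.
Local Open Scope ring_scope.

Definition dx (R : realType) (V : normedModType R) (f : R * R -> V) :
  R * R -> V := 'D_(1, 0) f.

Definition dy (R : realType) (V : normedModType R) (f : R * R -> V) :
  R * R -> V := 'D_(0, 1) f.

(* C^oo on an open set: Frechet differentiability to all orders, i.e. every
   iterated directional derivative is Frechet differentiable on Omega. Maps are
   total functions, of which only the values on the open set Omega matter. *)
Definition smooth_on (R : realType) (V : normedModType R) (Omega : set (R * R))
    (f : R * R -> V) : Prop :=
  forall (s : seq (R * R)) (p : R * R), Omega p ->
    differentiable (foldr (fun v g => 'D_v g) f s) p.

Definition is_domain (R : realType) (Omega : set (R * R)) : Prop :=
  open Omega /\ connected Omega.

Definition bar (R : realType) (Y : 'M[R]_2) : 'M[R]_2 := (\tr Y)%:M - Y.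

Definition gl_inner (R : realType) (X Y : 'M[R]_2) : R :=
  - (2^-1 * \tr (X *m bar Y)).

Definition H31 (R : realType) : set 'M[R]_2 := [set X | gl_inner X X = -1].

Definition SL2 (R : realType) : set 'M[R]_2 := [set X | \det X = 1].

Definition lie (R : realType) (X Y : 'M[R]_2) : 'M[R]_2 := X *m Y - Y *m X.

Definition Ad (R : realType) (F X : 'M[R]_2) : 'M[R]_2 := F *m X *m invmx F.

Definition e3 (R : realType) : 'M[R]_2 := delta_mx 1 1 - delta_mx 0 0.
Definition xi1 (R : realType) : 'M[R]_2 := delta_mx 1 0.
Definition xi2 (R : realType) : 'M[R]_2 := delta_mx 0 1.
Arguments e3 {R}.
Arguments xi1 {R}.
Arguments xi2 {R}.

Definition is_sign (R : realType) (eps : R) : Prop := eps = 1 \/ eps = -1.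

Definition first_form (R : realType) (f : R * R -> 'M[R]_2) (p v w : R * R) : R :=
  gl_inner ('d f p v) ('d f p w).

(* A symmetric bilinear form on R^2 of signature (1,1); the two vectors are then
   automatically a basis. *)
Definition lorentzian (R : realType) (g : R * R -> R * R -> R) : Prop :=
  exists v w : R * R, [/\ 0 < g v v, g w w < 0 & g v w = 0].

Definition timelike_immersion (R : realType) (Omega : set (R * R))
    (f : R * R -> 'M[R]_2) : Prop :=
  smooth_on Omega f /\
  forall p, Omega p ->
    [/\ H31 (f p), injective ('d f p) & lorentzian (first_form f p)].

Definition null_coordinates (R : realType) (Omega : set (R * R))
    (f : R * R -> 'M[R]_2) (eps : R) (omega : R * R -> R) : Prop :=
  [/\ is_sign eps, smooth_on Omega omega &
    forall p, Omega p ->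
      [/\ gl_inner (dx f p) (dx f p) = 0, gl_inner (dy f p) (dy f p) = 0 &
          2 * gl_inner (dx f p) (dy f p) = eps * expR (omega p)]].

Definition unit_normal (R : realType) (Omega : set (R * R))
    (f N : R * R -> 'M[R]_2) : Prop :=
  smooth_on Omega N /\
  forall p, Omega p ->
    [/\ gl_inner (N p) (N p) = 1, gl_inner (N p) (f p) = 0,
        gl_inner (N p) (dx f p) = 0 & gl_inner (N p) (dy f p) = 0].

Definition gauss_map (R : realType) (f N : R * R -> 'M[R]_2) :
  R * R -> 'M[R]_2 := fun p => invmx (f p) *m N p.

Definition mean_curvature (R : realType) (f N : R * R -> 'M[R]_2)
    (eps : R) (omega : R * R -> R) : R * R -> R :=
  fun p => 2 * eps * expR (- omega p) * gl_inner (dy (dx f) p) (N p).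

Definition adapted_frame (R : realType) (Omega : set (R * R))
    (f N : R * R -> 'M[R]_2) (eps : R) (omega : R * R -> R)
    (F : R * R -> 'M[R]_2) : Prop :=
  [/\ smooth_on Omega F,
      forall p, Omega p -> SL2 (F p) &
      exists eps1 eps2 : R,
        [/\ is_sign eps1, is_sign eps2, eps1 * eps2 = eps &
          forall p, Omega p ->
            [/\ invmx (f p) *m dx f p
                  = (eps1 * expR (omega p / 2)) *: Ad (F p) xi1,
                invmx (f p) *m dy f p
                  = (eps2 * expR (omega p / 2)) *: Ad (F p) xi2 &
                N p = f p *m Ad (F p) e3]]].

(* Harmonicity with respect to the conformal structure for which (x, y) are null
   coordinates. *)
Definition harmonic_on (R : realType) (Omega : set (R * R))
    (nu : R * R -> 'M[R]_2) : Prop :=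
  forall p, Omega p -> lie (nu p) (dy (dx nu) p) = 0.

Definition constant_on (R : realType) (Omega : set (R * R))
    (h : R * R -> R) : Prop :=
  exists c, forall p, Omega p -> h p = c.

(* gl(2)-valued 1-forms: alpha p v is the value at p on the tangent vector v. *)
Definition one_form (R : realType) (U V : R * R -> 'M[R]_2) :
    R * R -> R * R -> 'M[R]_2 :=
  fun p v => v.1 *: U p + v.2 *: V p.

(* v and w are extended to constant, hence commuting, vector fields. *)
Definition ext_d (R : realType) (alpha : R * R -> R * R -> 'M[R]_2)
    (p v w : R * R) : 'M[R]_2 :=
  'D_v (alpha ^~ w) p - 'D_w (alpha ^~ v) p.

Definition bracket_form (R : realType) (alpha beta : R * R -> R * R -> 'M[R]_2)
    (p v w : R * R) : 'M[R]_2 :=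
  lie (alpha p v) (beta p w) - lie (alpha p w) (beta p v).

Definition maurer_cartan (R : realType) (Omega : set (R * R))
    (alpha : R * R -> R * R -> 'M[R]_2) : Prop :=
  forall p v w, Omega p ->
    ext_d alpha p v w + 2^-1 *: bracket_form alpha alpha p v w = 0.

Definition U_lambda (R : realType) (A1 A2 A3 : R * R -> R) (lambda : R) :
    R * R -> 'M[R]_2 :=
  fun p => (A1 p * lambda) *: xi1 + A2 p *: xi2 + A3 p *: e3.

Definition V_lambda (R : realType) (B1 B2 B3 : R * R -> R) (lambda : R) :
    R * R -> 'M[R]_2 :=
  fun p => B1 p *: xi1 + (B2 p * lambda^-1) *: xi2 + B3 p *: e3.

(* Main.v *)
Require Import Defs.
From mathcomp Require Import all_boot all_order all_algebra.
From mathcomp Require Import all_classical all_reals all_analysis.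
From mathcomp Require Import ring lra.

Set Implicit Arguments.
Unset Strict Implicit.
Unset Printing Implicit Defensive.

Import Order.TTheory GRing.Theory Num.Theory.
Import numFieldNormedType.Exports.

Local Open Scope classical_set_scope.
Local Open Scope ring_scope.

(** Put [u = expR (omega / 2)]. Comparing the two mixed derivatives of [f],
    written in the adapted frame, gives [omega_x = 4 A3], [omega_y = - 4 B3] and
    [H = 1 + 2 eps1 A1 / u = - 1 - 2 eps2 B2 / u], hence
      [H_x = - (2 eps2 / u) b]  and  [H_y = (2 eps1 / u) a],
    where [a = A1_y + 2 A1 B3] and [b = B2_x - 2 A3 B2]. On the other hand the
    integrability condition [F_xy = F_yx] makes the Maurer-Cartan expression of
    [alpha^lambda] equal to [(1 - lambda) a xi1 + (lambda^-1 - 1) b xi2], and,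
    up to conjugation by [F], [nu_xy] equal to [- 2 a xi1 + 2 b xi2] modulo [e3].
    Each of the three conditions thus says that [a = b = 0]. *)

(** * Directional derivatives of matrix-valued maps *)

Lemma is_derive_mxP (R : realFieldType) (V : normedModType R) (m n : nat)
    (A : V -> 'M[R]_(m, n)) (p v : V) (dA : 'M[R]_(m, n)) :
  is_derive p v A dA <-> forall i j, is_derive p v (fun q => A q i j) (dA i j).
Proof.
split=> [[dvA <-] i j|dvA].
  apply: DeriveDef; first by move/derivable_mxP: dvA.
  by rewrite derive_mx// mxE.
have dA' : derivable A p v by apply/derivable_mxP => i j; case: (dvA i j).
apply: DeriveDef => //; rewrite derive_mx//.
by apply/matrixP => i j; rewrite mxE derive_val.
Qed.

Lemma is_derive_mulmx (R : realFieldType) (V : normedModType R) (m n k : nat)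
    (A : V -> 'M[R]_(m, n)) (B : V -> 'M[R]_(n, k)) (p v : V)
    (dA : 'M[R]_(m, n)) (dB : 'M[R]_(n, k)) :
  is_derive p v A dA -> is_derive p v B dB ->
  is_derive p v (fun q => A q *m B q) (dA *m B p + A p *m dB).
Proof.
move=> /is_derive_mxP dA' /is_derive_mxP dB'; apply/is_derive_mxP => i j.
rewrite (_ : (fun q => _) = \sum_(l < n) (fun q => A q i l * B q l j));
  last first.
  by apply/funext => q; rewrite mxE fct_sumE.
rewrite !mxE -big_split /=.
apply: is_derive_sum => l.
apply: (@is_derive_eq _ _ _ _ _ _ _ _ (is_deriveM (dA' i l) (dB' l j))).
by rewrite /GRing.scale /=; ring.
Qed.

Lemma is_derive_scalemx (R : realFieldType) (V : normedModType R) (m n : nat)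
    (k : V -> R) (A : V -> 'M[R]_(m, n)) (p v : V)
    (dk : R) (dA : 'M[R]_(m, n)) :
  is_derive p v k dk -> is_derive p v A dA ->
  is_derive p v (fun q => k q *: A q) (dk *: A p + k p *: dA).
Proof.
move=> dk' /is_derive_mxP dA'; apply/is_derive_mxP => i j.
rewrite (_ : (fun q => _) = (k * (fun q => A q i j))); last first.
  by apply/funext => q; rewrite mxE.
apply: (@is_derive_eq _ _ _ _ _ _ _ _ (is_deriveM dk' (dA' i j))).
by rewrite !mxE /GRing.scale /=; ring.
Qed.

(** * Mean value theorem along segments and symmetry of second derivatives *)

Lemma is_derive_line (R : realType) (V : normedModType R) (g : V -> R)
    (p u : V) (t : R) :
  derivable g (p + t *: u) u ->
  is_derive t 1 (fun s : R => g (p + s *: u)) ('D_u g (p + t *: u)).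
Proof.
move=> dg.
have E : (fun h : R => h^-1 *: (((fun s : R => g (p + s *: u)) \o shift t)
    (h *: (1 : R)) - g (p + t *: u))) =
  (fun h : R => h^-1 *: ((g \o shift (p + t *: u)) (h *: u) - g (p + t *: u))).
  apply/funext => h /=.
  by rewrite [h%:A]mulr1 scalerDl addrCA.
apply: DeriveDef; first by rewrite /derivable E.
by rewrite /derive E.
Qed.

Lemma MVT_line (R : realType) (V : normedModType R) (g : V -> R) (p u : V)
    (h : R) : 0 < h ->
  (forall t, 0 <= t <= h -> derivable g (p + t *: u) u) ->
  exists2 t, 0 < t < h & g (p + h *: u) - g p = h * 'D_u g (p + t *: u).
Proof.
move=> h0 dg.
have [||t] := @MVT R (fun s : R => g (p + s *: u))
  (fun t => 'D_u g (p + t *: u)) 0 h h0.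
- move=> t /[!in_itv]/= /andP[t0 th]; apply: is_derive_line; apply: dg.
  by rewrite !ltW.
- apply: derivable_within_continuous => t /[!in_itv]/= th.
  by have [] := is_derive_line (dg _ th).
move=> /[!in_itv]/= th; rewrite scale0r addr0 subr0 => E.
by exists t => //; rewrite E mulrC.
Qed.

Lemma is_derive_translate (R : realType) (V W : normedModType R) (g : V -> W)
    (p u w : V) : derivable g (p + w) u ->
  is_derive p u (fun q => g (q + w)) ('D_u g (p + w)).
Proof.
have E : (fun h : R => h^-1 *: (((fun q => g (q + w)) \o shift p) (h *: u)
    - g (p + w))) =
  (fun h : R => h^-1 *: ((g \o shift (p + w)) (h *: u) - g (p + w))).
  by apply/funext => h /=; rewrite addrA.
by move=> dg; apply: DeriveDef; rewrite /derivable /derive E.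
Qed.

(* Two applications of the mean value theorem; exchanging [u] and [v] leaves the
   left-hand side unchanged, which yields the symmetry of second derivatives. *)
Lemma second_difference (R : realType) (V : normedModType R) (g : V -> R)
    (p u v : V) (h : R) : 0 < h ->
  (forall s t, 0 <= s <= h -> 0 <= t <= h ->
     derivable g (p + s *: u + t *: v) u /\
     derivable ('D_u g) (p + s *: u + t *: v) v) ->
  exists s t, [/\ 0 < s < h, 0 < t < h &
    g (p + h *: u + h *: v) - g (p + h *: u) - g (p + h *: v) + g p =
    h * h * 'D_v ('D_u g) (p + s *: u + t *: v)].
Proof.
move=> h0 dg.
have hh : 0 <= h <= h by rewrite lexx ltW.
have h00 : 0 <= (0 : R) <= h by rewrite lexx ltW.
(* The second difference is the increment of [G] along [h *: u]. The mean value theorem is applied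
   to [G] along [u], then to ['D_u g] along [v]. *)
pose G q := g (q + h *: v) - g q.
have dG s : 0 <= s <= h -> is_derive (p + s *: u) u G
    ('D_u g (p + s *: u + h *: v) - 'D_u g (p + s *: u)).
  move=> sh; apply: is_deriveB.
    by apply: is_derive_translate; have [] := dg _ _ sh hh.
  have [+ _] := dg _ _ sh h00; rewrite scale0r addr0; exact: derivableP.
have [|s sh E] := @MVT_line R V G p u h h0.
  by move=> t th; case: (dG _ th).
have sh' : 0 <= s <= h by case/andP: sh => ? ?; rewrite !ltW.
have [|t th E'] := @MVT_line R V ('D_u g) (p + s *: u) v h h0.
  by move=> t th; have [] := dg _ _ sh' th.
exists s, t; split=> //.
rewrite -mulrA -E' -[X in _ = _ * X](@derive_val _ _ _ _ _ _ _ (dG _ sh')) -E.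
by rewrite /G; ring.
Qed.

Lemma near_parallelogram (R : realType) (V : normedModType R) (B : set V)
    (p u v : V) : nbhs p B ->
  exists2 h : R, 0 < h & forall s t, 0 <= s <= h -> 0 <= t <= h ->
    B (p + s *: u + t *: v).
Proof.
move=> /nbhs_ballP[e /= e0 eB].
(* The summand 1 keeps the divisor positive even when [u] and [v] both vanish. *)
have K0 : 0 < 1 + `|u| + `|v| by rewrite ltr_pwDl// ltr_pwDl.
have h0 : 0 < e / 2 / (1 + `|u| + `|v|) by rewrite divr_gt0// divr_gt0.
exists (e / 2 / (1 + `|u| + `|v|)) => // s t /andP[s0 sh] /andP[t0 th].
apply: eB; rewrite -ball_normE /= opprD addrA opprD addrA subrr sub0r -opprD.
rewrite normrN.
apply: le_lt_trans (ler_normD _ _) _.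
rewrite !normrZ (ger0_norm s0) (ger0_norm t0).
apply: (@le_lt_trans _ _ (e / 2)); last by lra.
apply: (@le_trans _ _ (e / 2 / (1 + `|u| + `|v|) * (1 + `|u| + `|v|))); last first.
  by rewrite divfK// gt_eqF.
rewrite mulrDr mulrDr mulr1 -addrA -[leLHS]add0r lerD ?(ltW h0)//.
by rewrite lerD// ler_wpM2r.
Qed.

(** On a small parallelogram at [p], [second_difference] taken in both orders produces one point for
    each mixed derivative at which the two values agree. By continuity each value is within half the
    supposed gap of its value at [p], which contradicts the triangle inequality. *)
Lemma schwarz (R : realType) (V : normedModType R) (D : set V) (g : V -> R)
    (p u v : V) : open D -> D p ->
  (forall q, D q -> [/\ derivable g q u, derivable g q v,
     derivable ('D_u g) q v & derivable ('D_v g) q u]) ->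
  {for p, continuous ('D_v ('D_u g))} -> {for p, continuous ('D_u ('D_v g))} ->
  'D_v ('D_u g) p = 'D_u ('D_v g) p.
Proof.
move=> oD Dp dg cvu cuv.
apply/eqP/negPn/negP => /eqP ne.
pose e := `|'D_v ('D_u g) p - 'D_u ('D_v g) p| / 2.
have e0 : 0 < e.
  rewrite /e; move: ('D_v _ p) ('D_u _ p) ne {e} => a b /eqP ab.
  by rewrite divr_gt0// normr_gt0 subr_eq0.
clear ne.
have nD : nbhs p D by exact: open_nbhs_nbhs.
move/cvgrPdist_lt: cvu => /(_ _ e0) nvu.
move/cvgrPdist_lt: cuv => /(_ _ e0) nuv.
have [h h0 hB] := near_parallelogram u v (filterI nD (filterI nvu nuv)).
have [|s [t [/andP[s0 sh] /andP[t0 th] E]]] :=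
  @second_difference R V g p u v h h0.
  by move=> s t sh th; have [/dg[]] := hB _ _ sh th.
have [|t' [s' [/andP[t0' th'] /andP[s0' sh'] E']]] :=
  @second_difference R V g p v u h h0.
  move=> t' s' th' sh'; rewrite [p + t' *: v + _]addrAC.
  by have [/dg[_ gv _ gvu] _] := hB _ _ sh' th'; split.
have st : 0 <= s <= h /\ 0 <= t <= h by rewrite !ltW.
have st' : 0 <= s' <= h /\ 0 <= t' <= h by rewrite !ltW.
have [_ [H1 _]] := hB _ _ st.1 st.2.
have [_ [_ H2]] := hB _ _ st'.1 st'.2.
have {E E'} X : h * h * 'D_v ('D_u g) (p + s *: u + t *: v) =
    h * h * 'D_u ('D_v g) (p + t' *: v + s' *: u).
  by apply: etrans (esym E) (etrans _ E'); rewrite [p + h *: v + _]addrAC; ring.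
move: X H1 H2; rewrite [p + s' *: u + _]addrAC /e.
move: ('D_v ('D_u g) p) ('D_u ('D_v g) p) ('D_v ('D_u g) _) ('D_u ('D_v g) _).
move=> a b c d /(mulfI (mulf_neq0 (lt0r_neq0 h0) (lt0r_neq0 h0))) <- H1 H2.
have := ler_distD c a b.
rewrite leNgt => /negP; apply.
by rewrite [ltRHS](splitr _) ltrD// distrC.
Qed.

(** * Functions with vanishing derivative on a connected open set *)

Lemma locally_constant (R : realType) (V : normedModType R) (D : set V)
    (g : V -> R) (p : V) : open D -> D p ->
  (forall q v, D q -> is_derive q v g 0) -> \forall q \near p, g q = g p.
Proof.
move=> oD Dp dg.
have /nbhs_ballP[e /= e0 eD] : nbhs p D by exact: open_nbhs_nbhs.
apply/nbhs_ballP; exists e => //= q; rewrite -ball_normE /= => pq.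
(* Balls are convex, so the segment from [p] to [q] stays in [D] and the mean value theorem applies
   along it. *)
have Dt t : 0 <= t <= 1 -> D (p + t *: (q - p)).
  move=> /andP[t0 t1].
  apply: eD; rewrite -ball_normE /= opprD addrA subrr sub0r normrN.
  rewrite normrZ ger0_norm//.
  rewrite distrC in pq; apply: le_lt_trans pq.
  by rewrite ler_piMl.
have [|t /andP[t0 t1]] := @MVT_line R V g p (q - p) 1 ltr01.
  by move=> t /Dt /dg => /(_ (q - p)) [].
have Dt' : D (p + t *: (q - p)) by apply: Dt; rewrite !ltW.
rewrite (@derive_val _ _ _ _ _ _ _ (dg _ (q - p) Dt')) mulr0 scale1r subrKC.
by move/eqP; rewrite subr_eq0 => /eqP.
Qed.

Lemma connected_constant (R : realType) (V : normedModType R) (D : set V)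
    (g : V -> R) : open D -> connected D ->
  (forall q v, D q -> is_derive q v g 0) ->
  exists c, forall p, D p -> g p = c.
Proof.
move=> oD cD dg.
have [[p Dp]|D0] := pselect (D !=set0); last first.
  by exists 0 => p Dp; case: D0; exists p.
exists (g p) => q Dq.
(* Since [g] is locally constant, any condition on its values cuts out an open set. Applied to
   equality with [g p] and to its negation, this makes the level set of [p] open and closed in
   [D]. *)
have oB P : open (D `&` [set r | P (g r)]).
  rewrite openE => r [Dr gr]; rewrite /interior.
  have nc := locally_constant oD Dr dg; near=> s.
  split=> /=; first by near: s; exact: open_nbhs_nbhs.
  by rewrite (_ : g s = g r)//; near: s; exact: nc.
have : D `&` [set r | g r = g p] = D.
  apply: cD; first by exists p.
    exists (D `&` [set r | g r = g p]); first exact: (oB (fun x => x = g p)).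
    by rewrite setIA setIid.
  exists (~` (D `&` [set r | g r <> g p])).
    by apply: open_closedC; exact: (oB (fun x => x <> g p)).
  apply/seteqP; split=> r [Dr gr]; split=> //=; first by case.
  by apply: contrapT => ngr; apply: gr.
by move/seteqP => [_ /(_ q Dq)[]].
Unshelve. all: by end_near. Qed.

(** * Two-by-two matrices given by their entries *)

Definition mx2 (R : realType) (a b c d : R) : 'M[R]_2 :=
  \matrix_(i < 2, j < 2) if i == 0 then (if j == 0 then a else b)
                         else (if j == 0 then c else d).

Lemma ord2P (i : 'I_2) : i = 0 \/ i = 1.
Proof. by case: i => [[|[|//]]] ?; [left|right]; apply: val_inj. Qed.

Lemma mx2_eta (R : realType) (A : 'M[R]_2) :
  A = mx2 (A 0 0) (A 0 1) (A 1 0) (A 1 1).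
Proof.
by apply/matrixP => i j; rewrite mxE; case: (ord2P i) => ->; case: (ord2P j) => ->.
Qed.

Lemma mx2_inj (R : realType) (a b c d a' b' c' d' : R) :
  mx2 a b c d = mx2 a' b' c' d' -> [/\ a = a', b = b', c = c' & d = d'].
Proof.
by move/matrixP => E; split; [have := E 0 0|have := E 0 1|have := E 1 0|have := E 1 1];
  rewrite !mxE.
Qed.

Ltac mx2_entries :=
  let i := fresh in let j := fresh in
  apply/matrixP => i j; rewrite !mxE ?big_ord_recl ?big_ord0 ?mxE;
  case: (ord2P i) => ->; case: (ord2P j) => -> /=.

Section mx2_theory.
Variable R : realType.
Implicit Types a b c d k : R.

Lemma mx2D a b c d a' b' c' d' :
  mx2 a b c d + mx2 a' b' c' d' = mx2 (a + a') (b + b') (c + c') (d + d').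
Proof. by mx2_entries. Qed.

Lemma mx2N a b c d : - mx2 a b c d = mx2 (- a) (- b) (- c) (- d).
Proof. by mx2_entries. Qed.

Lemma mx2Z k a b c d : k *: mx2 a b c d = mx2 (k * a) (k * b) (k * c) (k * d).
Proof. by mx2_entries. Qed.

Lemma mx2M a b c d a' b' c' d' :
  mx2 a b c d *m mx2 a' b' c' d' =
  mx2 (a * a' + b * c') (a * b' + b * d') (c * a' + d * c') (c * b' + d * d').
Proof. by mx2_entries; rewrite ?addr0. Qed.

Lemma mx2_scalar k : k%:M = mx2 k 0 0 k.
Proof. by mx2_entries. Qed.

Lemma mx2_0 : 0 = mx2 0 0 0 0 :> 'M[R]_2.
Proof. by mx2_entries. Qed.

Lemma mx2_xi1 : xi1 = mx2 0 0 1 0 :> 'M[R]_2.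
Proof. by mx2_entries. Qed.

Lemma mx2_xi2 : xi2 = mx2 0 1 0 0 :> 'M[R]_2.
Proof. by mx2_entries. Qed.

Lemma mx2_e3 : e3 = mx2 (-1) 0 0 1 :> 'M[R]_2.
Proof. by mx2_entries; rewrite ?subr0 ?sub0r. Qed.

Lemma mx2_tr a b c d : \tr (mx2 a b c d) = a + d.
Proof. by rewrite /mxtrace !big_ord_recl big_ord0 !mxE /= addr0. Qed.

Lemma mx2_det a b c d : \det (mx2 a b c d) = a * d - b * c.
Proof.
rewrite (expand_det_row _ 0) !big_ord_recl big_ord0 /cofactor !det_mx11 !mxE /=.
by rewrite expr0 expr1; ring.
Qed.

Lemma mx2_bar a b c d : bar (mx2 a b c d) = mx2 d (- b) (- c) a.
Proof.
by rewrite /bar mx2_tr mx2_scalar mx2N mx2D; congr mx2; ring.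
Qed.

(** Rewriting with these rules brings both sides of a matrix identity to the form [mx2 _ _ _ _], so
    that [congr mx2; ring] can finish entry by entry. *)
Definition mx2E := (mx2_xi1, mx2_xi2, mx2_e3, mx2_scalar, mx2_0, mx2Z, mx2M, mx2N,
  mx2D, mx2_tr, mx2_det, mx2_bar).

End mx2_theory.

(** * Algebra of sl(2), with [bar] as adjugate *)

Section sl2_algebra.
Variable R : realType.
Implicit Types (X Y P Q W : 'M[R]_2) (a b c : R).

(** Unfolds to the right-hand sides of [hA] and [hB], so those hypotheses can be used as they
    stand. *)
Definition sl2 a b c : 'M[R]_2 := a *: xi1 + b *: xi2 + c *: e3.

Lemma sl2E a b c : sl2 a b c = mx2 (- c) b a c.
Proof. by rewrite /sl2 !mx2E; congr mx2; ring. Qed.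

Lemma sl2_eq0 a b c : sl2 a b c = 0 <-> [/\ a = 0, b = 0 & c = 0].
Proof.
rewrite sl2E mx2_0; split=> [/mx2_inj[_ -> -> ->]//|[-> -> ->]].
by rewrite oppr0.
Qed.

Lemma bar_sl2 a b c : bar (sl2 a b c) = - sl2 a b c.
Proof. by rewrite sl2E !mx2E; congr mx2; ring. Qed.

Lemma lie_sl2 a b c a' b' c' : lie (sl2 a b c) (sl2 a' b' c') =
  sl2 (2 * (c * a' - a * c')) (2 * (b * c' - c * b')) (a * b' - b * a').
Proof. by rewrite /lie !sl2E !mx2E; congr mx2; ring. Qed.

Lemma sl2D a b c a' b' c' :
  sl2 a b c + sl2 a' b' c' = sl2 (a + a') (b + b') (c + c').
Proof. by rewrite !sl2E !mx2E; congr mx2; ring. Qed.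

Lemma lie_sl2_e3 a b c : lie (sl2 a b c) e3 = sl2 ((-2) * a) (2 * b) 0.
Proof. by rewrite /lie !sl2E !mx2E; congr mx2; ring. Qed.

Lemma lie_e3_sl2 a b c : lie e3 (sl2 a b c) = sl2 (2 * a) ((-2) * b) 0.
Proof. by rewrite /lie !sl2E !mx2E; congr mx2; ring. Qed.

Lemma barM X Y : bar (X *m Y) = bar Y *m bar X.
Proof.
by rewrite (mx2_eta X) (mx2_eta Y) !mx2E; congr mx2; ring.
Qed.

Lemma mulmx_bar X : X *m bar X = (\det X)%:M.
Proof. by rewrite (mx2_eta X) !mx2E; congr mx2; ring. Qed.

Lemma bar_mulmx X : bar X *m X = (\det X)%:M.
Proof. by rewrite (mx2_eta X) !mx2E; congr mx2; ring. Qed.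

Lemma gl_inner_self X : gl_inner X X = - \det X.
Proof. by rewrite /gl_inner (mx2_eta X) !mx2E; field. Qed.

(** [gl_inner] is the polarization of minus the determinant, which is multiplicative. The factors
    [f], [F] and [bar F] thus drop out of the inner product defining the mean curvature. *)
Lemma gl_inner_mul P Q X Y :
  gl_inner (P *m X *m Q) (P *m Y *m Q) =
  \det P * \det Q * gl_inner X Y.
Proof.
rewrite /gl_inner.
have -> : P *m X *m Q *m bar (P *m Y *m Q) =
    \det Q *: (P *m (X *m bar Y *m bar P)).
  rewrite !barM !mulmxA -(mulmxA _ Q (bar Q)) mulmx_bar mul_mx_scalar.
  by rewrite -!scalemxAl.
rewrite mxtraceZ mxtrace_mulC -(mulmxA _ (bar P)) bar_mulmx mul_mx_scalar.
rewrite mxtraceZ.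
ring.
Qed.

Lemma mulmx_unit_inj P X Y : \det P = 1 -> P *m X = P *m Y -> X = Y.
Proof.
move=> dP /(congr1 (mulmx (bar P))).
by rewrite !mulmxA bar_mulmx dP !mul1mx.
Qed.

Lemma conj_eq0 P X : \det P = 1 -> P *m X *m bar P = 0 <-> X = 0.
Proof.
move=> dP; split=> [/(congr1 (mulmx^~ P))|->]; last by rewrite mulmx0 mul0mx.
rewrite -mulmxA bar_mulmx dP mulmx1 mul0mx => PX.
by apply: (mulmx_unit_inj dP); rewrite mulmx0.
Qed.

(** Replaces the inverse by a linear map of the entries, which [is_derive_bar] differentiates
    directly. *)
Lemma invmx_det1 P : \det P = 1 -> invmx P = bar P.
Proof.
move=> dP; have uP : P \in unitmx by rewrite unitmxE dP unitr1.
by apply: (mulmx_unit_inj dP); rewrite mulmxV// mulmx_bar dP.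
Qed.

End sl2_algebra.

(** * Calculus for frames and their coefficients *)

Lemma barE (R : realType) (A : 'M[R]_2) i j :
  bar A i j = (i == j)%:R * (A 0 0 + A 1 1) - A i j.
Proof.
rewrite /bar !mxE mulr_natl; congr (_ *+ _ - _).
by rewrite {1}(mx2_eta A) mx2_tr.
Qed.

Lemma is_derive_bar (R : realType) (V : normedModType R) (A : V -> 'M[R]_2)
    (p v : V) (dA : 'M[R]_2) :
  is_derive p v A dA -> is_derive p v (fun q => bar (A q)) (bar dA).
Proof.
move=> /is_derive_mxP dA'; apply/is_derive_mxP => i j.
rewrite (_ : (fun q => _) =
    (i == j)%:R *: ((fun q => A q 0 0) + (fun q => A q 1 1)) - (fun q => A q i j)).
  by rewrite barE; apply: is_deriveB; apply: is_deriveZ; apply: is_deriveD.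
by apply/funext => q; rewrite barE.
Qed.

Lemma is_derive_sl2 (R : realType) (V : normedModType R) (a b c : V -> R)
    (p v : V) (da db dc : R) :
  is_derive p v a da -> is_derive p v b db -> is_derive p v c dc ->
  is_derive p v (fun q => sl2 (a q) (b q) (c q)) (sl2 da db dc).
Proof.
move=> a' b' c'.
have L (k : V -> R) (dk : R) (X : 'M[R]_2) : is_derive p v k dk ->
    is_derive p v (fun q => k q *: X) (dk *: X).
  move=> k'; apply: (@is_derive_eq _ _ _ _ _ _ _ _
    (is_derive_scalemx k' (is_derive_cst X p v))).
  by rewrite scaler0 addr0.
exact: (is_deriveD (is_deriveD (L _ _ xi1 a') (L _ _ xi2 b')) (L _ _ e3 c')).
Qed.

Lemma is_derive_expR_comp (R : realType) (V : normedModType R) (g : V -> R)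
    (p v : V) : differentiable g p ->
  is_derive p v (fun q => expR (g q)) (expR (g p) * 'D_v g p).
Proof.
move=> dg.
have de : differentiable (@expR R) (g p) by apply/derivable1_diffP.
have dc : differentiable (fun q => expR (g q)) p by exact: differentiable_comp.
apply: DeriveDef; first exact: diff_derivable.
rewrite deriveE// (_ : (fun q => _) = @expR R \o g)// diff_comp// deriveE//=.
by rewrite deriv1E// derive1E derive_val /GRing.scale /= mulrC.
Qed.

(** Here [g] is controlled only near [p], through its agreement with [k]. The derivative of [k] is
    linear in the direction, and directional derivatives, being local, carry this over to [g]. *)
Lemma is_derive_plane (R : realType) (g k : R * R -> R) (p v : R * R) :
  (\near p, k p = g p) -> differentiable k p ->
  is_derive p v g (v.1 * dx g p + v.2 * dy g p).
Proof.
move=> kg dk; apply: (@near_eq_is_derive _ _ _ k g p v _ kg).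
have gk : \near p, g p = k p by apply: filterS kg => r /esym.
rewrite /dx /dy !(near_eq_derive _ gk).
apply: DeriveDef; first exact: diff_derivable.
rewrite !deriveE// [in LHS](_ : v = v.1 *: (1, 0) + v.2 *: (0, 1)).
  by rewrite linearD !linearZ.
by case: v => a b; congr pair; rewrite /= /GRing.scale /= ?mulr1 ?mulr0 ?addr0 ?add0r.
Qed.

Lemma differentiable_entry (R : realType) (V : normedModType R) (m n : nat)
    (A : V -> 'M[R]_(m, n)) (p : V) i j :
  differentiable A p -> differentiable (fun q => A q i j) p.
Proof.
move=> dA.
exact: (@differentiable_comp _ _ _ _ A (fun M : 'M[R]_(m, n) => M i j : R) p dA
  (differentiable_coord _ _ _)).
Qed.

Lemma differentiable_bar_mulmx (R : realType) (V : normedModType R)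
    (A B : V -> 'M[R]_2) (p : V) i j :
  differentiable A p -> differentiable B p ->
  differentiable (fun q => (bar (A q) *m B q) i j) p.
Proof.
move=> dA dB.
have dAe k l := differentiable_entry k l dA.
have dBe k l := differentiable_entry k l dB.
have [->|->] := ord2P i.
  rewrite (_ : (fun q => _) = (fun q => A q 1 1) * (fun q => B q 0 j) -
    (fun q => A q 0 1) * (fun q => B q 1 j)).
    by apply: differentiableB; apply: differentiableM.
  apply/funext => q; rewrite {1}(mx2_eta (A q)) {1}(mx2_eta (B q)) !mx2E mxE.
  by rewrite !fctE; have [->|->] := ord2P j => /=; rewrite mulNr.
rewrite (_ : (fun q => _) = (fun q => A q 0 0) * (fun q => B q 1 j) -
  (fun q => A q 1 0) * (fun q => B q 0 j)).
  by apply: differentiableB; apply: differentiableM.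
apply/funext => q; rewrite {1}(mx2_eta (A q)) {1}(mx2_eta (B q)) !mx2E mxE.
by rewrite !fctE; have [->|->] := ord2P j => /=; rewrite mulNr addrC.
Qed.

(** Reduces to the scalar [schwarz] on each entry. Entries of ['D_w f] agree with derivatives of
    entries only on [D], so derivability and continuity are transferred through neighbourhoods. *)
Lemma smooth_schwarz (R : realType) (D : set (R * R)) (m n : nat)
    (f : R * R -> 'M[R]_(m, n)) (p u v : R * R) :
  open D -> smooth_on D f -> D p -> 'D_v ('D_u f) p = 'D_u ('D_v f) p.
Proof.
move=> oD sf Dp.
have nD q : D q -> nbhs q D by move=> Dq; exact: open_nbhs_nbhs.
have df0 q : D q -> differentiable f q := sf [::] q.
have df1 w q : D q -> differentiable ('D_w f) q := sf [:: w] q.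
have df2 w w' q : D q -> differentiable ('D_w ('D_w' f)) q := sf [:: w; w'] q.
apply/matrixP => i j.
pose g q := f q i j.
have E1 w q : D q -> is_derive q w g ('D_w f q i j).
  move=> Dq; move: i j @g; apply/is_derive_mxP/derivableP/diff_derivable.
  exact: df0.
have E2 w w' q : D q -> is_derive q w ('D_w' g) ('D_w ('D_w' f) q i j).
  move=> Dq; apply: (@near_eq_is_derive _ _ _ (fun q => 'D_w' f q i j)).
    near=> r; have Dr : D r by near: r; exact: nD.
    by have [_ ->] := E1 w' _ Dr.
  move: i j {g E1}; apply/is_derive_mxP/derivableP/diff_derivable.
  exact: df1.
have C w w' : {for p, continuous ('D_w ('D_w' g))}.
  have c : {for p, continuous (fun q => 'D_w ('D_w' f) q i j)}.
    exact/differentiable_continuous/differentiable_entry/df2.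
  rewrite /prop_for /continuous_at (@derive_val _ _ _ _ _ _ _ (E2 w w' _ Dp)).
  apply: cvg_trans c; apply: near_eq_cvg.
  near=> r; have Dr : D r by near: r; exact: nD.
  by have [_ ->] := E2 w w' _ Dr.
have [_ Evu] := E2 v u _ Dp; have [_ Euv] := E2 u v _ Dp.
apply: etrans (esym Evu) (etrans _ Euv).
apply: (schwarz oD Dp) => [q Dq|//|//].
by split; [case: (E1 u q Dq)|case: (E1 v q Dq)
  |case: (E2 v u q Dq)|case: (E2 u v q Dq)].
Unshelve. all: by end_near. Qed.

(* Linearity of [v |-> 'D_v g p] is all that is needed of Frechet
   differentiability, and it depends only on the values of [g] near [p]. *)
Definition plane_derivable (R : realType) (D : set (R * R)) (g : R * R -> R) :=
  forall p v, D p -> is_derive p v g (v.1 * dx g p + v.2 * dy g p).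

Lemma plane_derivable_dx (R : realType) (D : set (R * R)) (g : R * R -> R) p :
  plane_derivable D g -> D p -> is_derive p (1, 0) g (dx g p).
Proof. by move=> dg Dp; apply/derivableP; case: (dg p (1, 0) Dp). Qed.

Lemma plane_derivable_dy (R : realType) (D : set (R * R)) (g : R * R -> R) p :
  plane_derivable D g -> D p -> is_derive p (0, 1) g (dy g p).
Proof. by move=> dg Dp; apply/derivableP; case: (dg p (0, 1) Dp). Qed.

Lemma near_on (T : topologicalType) (D : set T) (P : T -> Prop) (p : T) :
  open D -> D p -> (forall q, D q -> P q) -> \forall q \near p, P q.
Proof.
move=> oD Dp DP; have : nbhs p D by exact: open_nbhs_nbhs.
exact: filterS.
Qed.

Lemma eq_derive_on (R : numFieldType) (V W : normedModType R) (D : set V)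
    (f g : V -> W) (p v : V) :
  open D -> D p -> (forall q, D q -> f q = g q) -> 'D_v f p = 'D_v g p.
Proof. by move=> oD Dp fg; apply: near_eq_derive; exact: near_on fg. Qed.

(** No regularity of [a], [b], [c] is assumed: on [D] they are the entries (1,0), (0,1) and (1,1) of
    the differentiable product of [bar F] and [G], and regularity comes from there. *)
Lemma coefs_derivable (R : realType) (D : set (R * R)) (F G : R * R -> 'M[R]_2)
    (a b c : R * R -> R) : open D ->
  (forall q, D q -> differentiable F q) -> (forall q, D q -> differentiable G q) ->
  (forall q, D q -> bar (F q) *m G q = sl2 (a q) (b q) (c q)) ->
  [/\ plane_derivable D a, plane_derivable D b & plane_derivable D c].
Proof.
move=> oD dF dG E.
split=> p v Dp; [pose i : 'I_2 := 1; pose j : 'I_2 := 0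
  |pose i : 'I_2 := 0; pose j : 'I_2 := 1|pose i : 'I_2 := 1; pose j : 'I_2 := 1].
all: apply: (@is_derive_plane _ _ (fun q => (bar (F q) *m G q) i j));
  [apply: (near_on oD Dp) => q Dq; rewrite E// sl2E mxE //
  |apply: differentiable_bar_mulmx; [exact: dF|exact: dG]].
Qed.

Lemma is_derive_expR_scale (R : realType) (V : normedModType R) (g : V -> R)
    (c : R) (p v : V) : differentiable g p ->
  is_derive p v (fun q => expR (g q * c)) (expR (g p * c) * (c * 'D_v g p)).
Proof.
move=> dg.
rewrite (_ : (fun q => _) = (fun q => expR ((c *: g) q))); last first.
  by apply/funext => q; rewrite [g q * c]mulrC.
apply: (@is_derive_eq _ _ _ _ _ _ _ _ (is_derive_expR_comp v (differentiableZ c dg))).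
rewrite deriveZ; last exact: diff_derivable.
by congr (expR _ * _); exact: mulrC.
Qed.

(** As [bar] reverses products and [bar U = - U], the derivative of [bar F] is [- U *m bar F]. The
    two outer terms of the product rule then combine into a commutator. *)
Lemma is_derive_conj (R : realType) (V : normedModType R) (F W : V -> 'M[R]_2)
    (p v : V) (U dW : 'M[R]_2) : bar U = - U ->
  is_derive p v F (F p *m U) -> is_derive p v W dW ->
  is_derive p v (fun q => F q *m W q *m bar (F q))
    (F p *m (lie U (W p) + dW) *m bar (F p)).
Proof.
move=> bU dF dW'.
apply: (@is_derive_eq _ _ _ _ _ _ _ _
  (is_derive_mulmx (is_derive_mulmx dF dW') (is_derive_bar dF))).
rewrite barM bU /lie; move: (bar (F p)) => G.
rewrite mulNmx mulmxN !mulmxDr !mulmxDl !mulmxN !mulNmx !mulmxA.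
by rewrite addrAC.
Qed.

(** * Structure equations of the frame, harmonicity and the loop of forms *)

Section Frame.
Context {R : realType} {D : set (R * R)} {F : R * R -> 'M[R]_2}.
Context {A1 A2 A3 B1 B2 B3 : R * R -> R}.
Hypothesis oD : open D.
Hypothesis sF : smooth_on D F.
Hypothesis detF : forall p, D p -> \det (F p) = 1.
Hypothesis Fx : forall p, D p -> dx F p = F p *m sl2 (A1 p) (A2 p) (A3 p).
Hypothesis Fy : forall p, D p -> dy F p = F p *m sl2 (B1 p) (B2 p) (B3 p).

Let dF p v : D p -> is_derive p v F ('D_v F p).
Proof. by move=> Dp; apply/derivableP/diff_derivable; exact: (sF [::]). Qed.

Let dFx p : D p -> is_derive p (1, 0) F (F p *m sl2 (A1 p) (A2 p) (A3 p)).
Proof. by move=> Dp; rewrite -Fx//; exact: dF. Qed.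

Let dFy p : D p -> is_derive p (0, 1) F (F p *m sl2 (B1 p) (B2 p) (B3 p)).
Proof. by move=> Dp; rewrite -Fy//; exact: dF. Qed.

Lemma frame_coefs_x :
  [/\ plane_derivable D A1, plane_derivable D A2 & plane_derivable D A3].
Proof.
apply: (@coefs_derivable _ _ F (dx F)) => // q Dq.
- exact: (sF [::]).
- exact: (sF [:: (1, 0)]).
- by rewrite Fx// mulmxA bar_mulmx detF// mul1mx.
Qed.

Lemma frame_coefs_y :
  [/\ plane_derivable D B1, plane_derivable D B2 & plane_derivable D B3].
Proof.
apply: (@coefs_derivable _ _ F (dy F)) => // q Dq.
- exact: (sF [::]).
- exact: (sF [:: (0, 1)]).
- by rewrite Fy// mulmxA bar_mulmx detF// mul1mx.
Qed.

(** With U and V the matrices of [Fx] and [Fy], the equality F_xy = F_yx reads F(VU + U_y) = F(UV +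
    V_x). Cancelling F leaves U_y - V_x = [U,V], read off entrywise. *)
Lemma frame_structure p : D p ->
  [/\ dy A1 p - dx B1 p = 2 * (A3 p * B1 p - A1 p * B3 p),
      dy A2 p - dx B2 p = 2 * (A2 p * B3 p - A3 p * B2 p) &
      dy A3 p - dx B3 p = A1 p * B2 p - A2 p * B1 p].
Proof.
move=> Dp.
have [a1 a2 a3] := frame_coefs_x; have [b1 b2 b3] := frame_coefs_y.
have dU := is_derive_sl2 (plane_derivable_dy a1 Dp) (plane_derivable_dy a2 Dp)
  (plane_derivable_dy a3 Dp).
have dV := is_derive_sl2 (plane_derivable_dx b1 Dp) (plane_derivable_dx b2 Dp)
  (plane_derivable_dx b3 Dp).
have [_ Exy] := is_derive_mulmx (dFy Dp) dU.
have [_ Eyx] := is_derive_mulmx (dFx Dp) dV.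
have Nx := @eq_derive_on _ _ _ _ _ _ _ ((0, 1) : R * R) oD Dp Fx.
have Ny := @eq_derive_on _ _ _ _ _ _ _ ((1, 0) : R * R) oD Dp Fy.
have E := etrans (esym (etrans Nx Exy)) (etrans (smooth_schwarz _ _ oD sF Dp)
  (etrans Ny Eyx)).
rewrite -!mulmxA -!mulmxDr in E.
have := mulmx_unit_inj (detF Dp) E.
rewrite !sl2E !mx2E => /mx2_inj[_ e2 e1 e3].
by split; lra.
Qed.

(** Conjugating back by F, nu becomes [e3] and nu_x becomes [lie U e3], which has no [e3] component.
    Bracketing nu_xy with [e3] retains exactly its [xi1] and [xi2] coefficients. *)
Lemma frame_gauss_harmonic p : D p ->
  lie (F p *m e3 *m bar (F p)) (dy (dx (fun q => F q *m e3 *m bar (F q))) p) = 0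
  <-> dy A1 p + 2 * (A1 p * B3 p) = 0 /\ dy A2 p - 2 * (A2 p * B3 p) = 0.
Proof.
move=> Dp.
have [a1 a2 _] := frame_coefs_x.
have nux q : D q -> dx (fun q => F q *m e3 *m bar (F q)) q =
    F q *m sl2 ((-2) * A1 q) (2 * A2 q) 0 *m bar (F q).
  move=> Dq.
  have [_ E] := is_derive_conj (bar_sl2 _ _ _) (dFx Dq) (is_derive_cst e3 q (1, 0)).
  apply: (etrans E); rewrite /cst.
  by rewrite addr0 lie_sl2_e3.
have dW := is_derive_sl2 (is_deriveZ (-2) (plane_derivable_dy a1 Dp))
  (is_deriveZ 2 (plane_derivable_dy a2 Dp)) (is_derive_cst 0 p (0, 1)).
have [_ E] := is_derive_conj (bar_sl2 _ _ _) (dFy Dp) dW.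
rewrite {1}/dy (eq_derive_on _ oD Dp nux) E.
(* Conjugation by F respects brackets because [bar (F p)] inverts [F p]. *)
have -> X Y : lie (F p *m X *m bar (F p)) (F p *m Y *m bar (F p)) =
    F p *m lie X Y *m bar (F p).
  have FF Z T : F p *m Z *m bar (F p) *m (F p *m T *m bar (F p)) =
      F p *m (Z *m T) *m bar (F p).
    by rewrite !mulmxA -(mulmxA _ (bar _) (F p)) bar_mulmx detF// mulmx1.
  by rewrite /lie !FF; move: (bar _) => G; rewrite mulmxBr mulmxBl.
rewrite lie_sl2 sl2D lie_e3_sl2 /= /GRing.scale /=.
apply: (iff_trans (conj_eq0 _ (detF Dp))); apply: (iff_trans (sl2_eq0 _ _ _)).
by split=> [[e1 e2 _]|[e1 e2]]; split; lra.
Qed.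

(** A 2-form on the plane is a multiple of the area form, whence the scalar factor. In the [e3]
    component lambda and its inverse cancel and the structure equation makes it vanish. In the other
    two components, subtracting the structure equation leaves only the terms that lambda
    rescales. *)
Lemma loop_maurer_cartan (lambda : R) p v w : D p -> lambda != 0 ->
  let alpha := one_form (U_lambda A1 A2 A3 lambda) (V_lambda B1 B2 B3 lambda) in
  ext_d alpha p v w + 2^-1 *: bracket_form alpha alpha p v w =
  (v.1 * w.2 - v.2 * w.1) *:
    sl2 ((1 - lambda) * (dy A1 p + 2 * (A1 p * B3 p)))
        ((lambda^-1 - 1) * (dx B2 p - 2 * (A3 p * B2 p))) 0.
Proof.
move=> Dp l0 alpha.
have [a1 a2 a3] := frame_coefs_x; have [b1 b2 b3] := frame_coefs_y.
have alphaE q t : alpha q t = sl2 (t.1 * lambda * A1 q + t.2 * B1 q)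
    (t.1 * A2 q + t.2 * lambda^-1 * B2 q) (t.1 * A3 q + t.2 * B3 q).
  rewrite /alpha /one_form /U_lambda /V_lambda !sl2E !mx2E.
  by congr mx2; ring.
have dalpha s t : 'D_s (alpha ^~ t) p =
    sl2 (t.1 * lambda * (s.1 * dx A1 p + s.2 * dy A1 p) +
           t.2 * (s.1 * dx B1 p + s.2 * dy B1 p))
        (t.1 * (s.1 * dx A2 p + s.2 * dy A2 p) +
           t.2 * lambda^-1 * (s.1 * dx B2 p + s.2 * dy B2 p))
        (t.1 * (s.1 * dx A3 p + s.2 * dy A3 p) +
           t.2 * (s.1 * dx B3 p + s.2 * dy B3 p)).
  apply: (etrans (congr1 (fun g => 'D_s g p) (funext (alphaE ^~ t)))).
  have C k l g h : plane_derivable D g -> plane_derivable D h ->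
      is_derive p s (fun q => k * g q + l * h q)
        (k * (s.1 * dx g p + s.2 * dy g p) + l * (s.1 * dx h p + s.2 * dy h p)).
    move=> dg dh.
    exact: (is_deriveD (is_deriveZ k (dg _ s Dp)) (is_deriveZ l (dh _ s Dp))).
  by have [_ ->] := is_derive_sl2 (C (t.1 * lambda) t.2 _ _ a1 b1)
    (C t.1 (t.2 * lambda^-1) _ _ a2 b2) (C t.1 t.2 _ _ a3 b3).
have [s1 s2 s3] := frame_structure Dp.
(* Each structure equation is solved for one derivative, so that substitution leaves an
   unconditional identity for [field]. *)
have {s1} E1 : dy A1 p = dx B1 p + 2 * (A3 p * B1 p - A1 p * B3 p) by lra.
have {s2} E2 : dx B2 p = dy A2 p - 2 * (A2 p * B3 p - A3 p * B2 p) by lra.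
have {s3} E3 : dy A3 p = dx B3 p + (A1 p * B2 p - A2 p * B1 p) by lra.
rewrite /ext_d /bracket_form !dalpha !alphaE !lie_sl2 E1 E2 E3 !sl2E !mx2E.
by congr mx2; field.
Qed.

End Frame.

(** * Compatibility of the immersion with its frame, and mean curvature *)

Lemma det_bar (R : realType) (X : 'M[R]_2) : \det (bar X) = \det X.
Proof. by rewrite (mx2_eta X) !mx2E; ring. Qed.

Section Surface.
Context {R : realType} {D : set (R * R)} {f N F : R * R -> 'M[R]_2}.
Context {eps eps1 eps2 : R} {omega A1 A2 A3 B1 B2 B3 : R * R -> R}.
Hypothesis oD : open D.
Hypothesis sf : smooth_on D f.
Hypothesis sF : smooth_on D F.
Hypothesis domega : forall p, D p -> differentiable omega p.
Hypothesis eps1_sqr : eps1 * eps1 = 1.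
Hypothesis eps2_sqr : eps2 * eps2 = 1.
Hypothesis epsM : eps1 * eps2 = eps.
Hypothesis detf : forall p, D p -> \det (f p) = 1.
Hypothesis detF : forall p, D p -> \det (F p) = 1.
Hypothesis Fx : forall p, D p -> dx F p = F p *m sl2 (A1 p) (A2 p) (A3 p).
Hypothesis Fy : forall p, D p -> dy F p = F p *m sl2 (B1 p) (B2 p) (B3 p).
Hypothesis fx : forall p, D p -> dx f p =
  f p *m (F p *m sl2 (eps1 * expR (omega p * 2^-1)) 0 0 *m bar (F p)).
Hypothesis fy : forall p, D p -> dy f p =
  f p *m (F p *m sl2 0 (eps2 * expR (omega p * 2^-1)) 0 *m bar (F p)).
Hypothesis NE : forall p, D p -> N p = f p *m (F p *m e3 *m bar (F p)).

Let dF p : D p ->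
  is_derive p (1, 0) F (F p *m sl2 (A1 p) (A2 p) (A3 p)) /\
  is_derive p (0, 1) F (F p *m sl2 (B1 p) (B2 p) (B3 p)).
Proof.
move=> Dp; rewrite -Fx// -Fy//.
by split; apply/derivableP/diff_derivable; exact: (sF [::]).
Qed.

Let df p v : D p -> is_derive p v f ('D_v f p).
Proof. by move=> Dp; apply/derivableP/diff_derivable; exact: (sf [::]). Qed.

Let conjM p X Y : D p ->
  f p *m (F p *m X *m bar (F p)) *m (F p *m Y *m bar (F p)) =
  f p *m F p *m (X *m Y) *m bar (F p).
Proof.
by move=> Dp; rewrite !mulmxA -(mulmxA _ (bar _) (F p)) bar_mulmx detF// mulmx1.
Qed.

Let mulmxA4 (X Y Z T : 'M[R]_2) : X *m (Y *m Z *m T) = X *m Y *m Z *m T.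
Proof. by rewrite !mulmxA. Qed.

Let fxy p (u := expR (omega p * 2^-1)) : D p ->
  dy (dx f) p = f p *m F p *m
    mx2 (eps * u ^+ 2 + eps1 * u * B2 p) 0
        (eps1 * u * (2 * B3 p + dy omega p / 2)) (- (eps1 * u * B2 p))
    *m bar (F p).
Proof.
move=> Dp; rewrite /dy (eq_derive_on _ oD Dp fx).
have de := @is_derive_expR_scale R (R * R)%type omega 2^-1 p (0, 1) (domega Dp).
have dW := is_derive_sl2 (is_deriveZ eps1 de)
  (@is_derive_cst R (R * R)%type R 0 p (0, 1))
  (@is_derive_cst R (R * R)%type R 0 p (0, 1)).
have [_ ->] := is_derive_mulmx (df (0, 1) Dp)
  (is_derive_conj (bar_sl2 _ _ _) (dF Dp).2 dW).
rewrite -/(dy f p) fy// conjM// mulmxA4 -mulmxDl -mulmxDr.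
congr (_ *m _ *m _).
rewrite lie_sl2 sl2D !sl2E !mx2E -epsM /= /GRing.scale /= -/u -/(dy omega p).
by congr mx2; ring.
Qed.

Let fyx p (u := expR (omega p * 2^-1)) : D p ->
  dx (dy f) p = f p *m F p *m
    mx2 (- (eps2 * u * A1 p)) (eps2 * u * (dx omega p / 2 - 2 * A3 p))
        0 (eps * u ^+ 2 + eps2 * u * A1 p)
    *m bar (F p).
Proof.
move=> Dp; rewrite /dx (eq_derive_on _ oD Dp fy).
have de := @is_derive_expR_scale R (R * R)%type omega 2^-1 p (1, 0) (domega Dp).
have dW := is_derive_sl2 (@is_derive_cst R (R * R)%type R 0 p (1, 0))
  (is_deriveZ eps2 de)
  (@is_derive_cst R (R * R)%type R 0 p (1, 0)).
have [_ ->] := is_derive_mulmx (df (1, 0) Dp)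
  (is_derive_conj (bar_sl2 _ _ _) (dF Dp).1 dW).
rewrite -/(dx f p) fx// conjM// mulmxA4 -mulmxDl -mulmxDr.
congr (_ *m _ *m _).
rewrite lie_sl2 sl2D !sl2E !mx2E -epsM /= /GRing.scale /= -/u -/(dx omega p).
by congr mx2; ring.
Qed.

(** Compares [fxy] with [fyx] after cancelling f, F and [bar F]. The entries (0,1), (1,0) and (0,0)
    give the three relations, once the nonzero factors [u], [eps1], [eps2] are divided out; the
    entry (1,1) repeats (0,0). *)
Lemma immersion_compatibility p (u := expR (omega p * 2^-1)) : D p ->
  [/\ dx omega p = 4 * A3 p, dy omega p = - 4 * B3 p &
      eps2 * A1 p + eps1 * B2 p = - eps * u].
Proof.
move=> Dp.
have u0 : u != 0 by rewrite gt_eqF// expR_gt0.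
have e10 : eps1 != 0.
  by apply/eqP => e0; move/eqP: eps1_sqr; rewrite e0 mul0r eq_sym oner_eq0.
have e20 : eps2 != 0.
  by apply/eqP => e0; move/eqP: eps2_sqr; rewrite e0 mul0r eq_sym oner_eq0.
have E : dy (dx f) p = dx (dy f) p := smooth_schwarz _ _ oD sf Dp.
move: E; rewrite fxy// fyx//.
move/(congr1 (mulmx^~ (F p))); rewrite -!(mulmxA _ (bar _)) bar_mulmx detF//.
rewrite !mulmx1 -!mulmxA => /(mulmx_unit_inj (detf Dp)).
move/(mulmx_unit_inj (detF Dp))/mx2_inj; rewrite -/u => -[E00 E01 E10 _].
split.
- have /eqP := esym E01; rewrite !mulf_eq0 (negPf u0) (negPf e20) /= => /eqP.
  lra.
- have /eqP := E10; rewrite !mulf_eq0 (negPf u0) (negPf e10) /= => /eqP.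
  lra.
- by apply: (mulfI u0); rewrite mulrDr; move: E00; lra.
Qed.

(** By [gl_inner_mul], the inner product of f_xy with N is that of the middle matrix in [fxy] with
    [e3], half the difference of its diagonal entries. This gives the formula in [B2]; the last
    relation of [immersion_compatibility] turns it into the one in [A1]. *)
Lemma mean_curvature_coefs p (m := expR (omega p * - 2^-1)) : D p ->
  mean_curvature f N eps omega p = 1 + 2 * eps1 * (A1 p * m) /\
  mean_curvature f N eps omega p = - 1 - 2 * eps2 * (B2 p * m).
Proof.
move=> Dp; have [_ _] := immersion_compatibility Dp.
rewrite /mean_curvature fxy// NE// !mulmxA gl_inner_mul.
rewrite det_mulmx det_bar detf// detF// !mul1r.
rewrite /gl_inner !mx2E.
have -> : expR (- omega p) = m ^+ 2.
  by rewrite expr2 -expRD; congr expR; field.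
set u := expR (omega p * 2^-1); have um : u * m = 1.
  by rewrite /u /m -expRD -mulrDr subrr mulr0 expR0.
rewrite -epsM => E.
set lhs := (X in X = _ /\ X = _).
(* Terms are grouped so that the squared signs and [u * m] can be rewritten to 1. *)
have -> : lhs = - (eps1 * eps1) * (eps2 * eps2) * (u * m) ^+ 2
    - 2 * eps2 * (eps1 * eps1) * (u * m) * (B2 p * m) by rewrite /lhs; field.
have EB : B2 p = - eps2 * u - eps1 * eps2 * A1 p.
  have := congr1 ( *%R eps1) E.
  rewrite mulrDr !mulrA mulrN mulrA eps1_sqr !mul1r mulNr => e.
  by rewrite -e; ring.
rewrite eps1_sqr eps2_sqr um; split; last by ring.
have -> : 2 * eps2 * 1 * 1 * (B2 p * m) =
    - (2 * (eps2 * eps2) * (u * m)) - 2 * eps1 * (eps2 * eps2) * (A1 p * m).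
  by rewrite EB; ring.
by rewrite eps2_sqr um; ring.
Qed.

(** Since omega_y = -4 B3, the [A1] formula for H differentiates in y to a multiple of A1_y + 2 A1
    B3. Since omega_x = 4 A3, the [B2] formula differentiates in x to a multiple of B2_x - 2 A3 B2.
    Each formula is used in its own direction. *)
Lemma is_derive_mean_curvature p v (m := expR (omega p * - 2^-1)) : D p ->
  is_derive p v (mean_curvature f N eps omega)
    (2 * m * (eps1 * v.2 * (dy A1 p + 2 * (A1 p * B3 p))
              - eps2 * v.1 * (dx B2 p - 2 * (A3 p * B2 p)))).
Proof.
move=> Dp.
have [ox oy _] := immersion_compatibility Dp.
have [a1 _ _] := frame_coefs_x oD sF detF Fx.
have [_ b2 _] := frame_coefs_y oD sF detF Fy.
have dm w : is_derive p w (fun q => expR (omega q * - 2^-1))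
    (m * (- 2^-1 * (w.1 * (4 * A3 p) + w.2 * (- 4 * B3 p)))).
  have := @is_derive_expR_scale R (R * R)%type omega (- 2^-1) p w (domega Dp).
  have [|_ ->] := @is_derive_plane R omega omega p w _ (domega Dp).
    by apply: (near_on oD Dp).
  by rewrite ox oy.
have H1 w : is_derive p w (mean_curvature f N eps omega)
    (2 * eps1 * m * (w.1 * (dx A1 p - 2 * (A1 p * A3 p))
                   + w.2 * (dy A1 p + 2 * (A1 p * B3 p)))).
  apply: (@near_eq_is_derive _ _ _
    (fun q => 1 + 2 * eps1 * (A1 q * expR (omega q * - 2^-1)))).
    by apply: (near_on oD Dp) => q Dq; have [->] := mean_curvature_coefs Dq.
  apply: (@is_derive_eq _ _ _ _ _ _ _ _ (is_deriveD
    (@is_derive_cst R (R * R)%type R 1 p w)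
    (is_deriveZ (2 * eps1) (is_deriveM (a1 _ w Dp) (dm w))))).
  by rewrite /GRing.scale /= -/m; field.
have H2 : is_derive p (1, 0) (mean_curvature f N eps omega)
    (- 2 * eps2 * m * (dx B2 p - 2 * (A3 p * B2 p))).
  apply: (@near_eq_is_derive _ _ _
    (fun q => -1 - 2 * eps2 * (B2 q * expR (omega q * - 2^-1)))).
    by apply: (near_on oD Dp) => q Dq; have [_ ->] := mean_curvature_coefs Dq.
  apply: (@is_derive_eq _ _ _ _ _ _ _ _ (is_deriveB
    (@is_derive_cst R (R * R)%type R (-1) p (1, 0))
    (is_deriveZ (2 * eps2) (is_deriveM (b2 _ (1, 0) Dp) (dm (1, 0)))))).
  by rewrite /GRing.scale /= -/m; field.
(* Both formulas compute H_x; equating them eliminates the x-derivative of [A1]. *)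
have [_ e1] := H1 (1, 0); have [_ e2] := H2.
have /= {e1 e2} E := etrans (esym e1) e2.
apply: (@is_derive_eq _ _ _ _ _ _ _ _ (H1 v)).
(* Isolates the left-hand side of [E] verbatim, factors 1 and 0 included, so that it can be
   rewritten. *)
transitivity (v.1 * (2 * eps1 * m * (1 * (dx A1 p - 2 * (A1 p * A3 p))
   + 0 * (dy A1 p + 2 * (A1 p * B3 p))))
   + 2 * eps1 * m * (v.2 * (dy A1 p + 2 * (A1 p * B3 p)))); first by ring.
by rewrite E; ring.
Qed.

End Surface.

(** * Assembly of the equivalences *)

Lemma sign_sqr (R : realType) (e : R) : is_sign e -> e * e = 1.
Proof. by case=> ->; rewrite ?mulrNN mulr1. Qed.

Lemma mulmx_invl (R : realType) (P X Y : 'M[R]_2) :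
  \det P = 1 -> invmx P *m X = Y -> X = P *m Y.
Proof.
by move=> dP <-; rewrite mulmxA invmx_det1// mulmx_bar dP mul1mx.
Qed.

Theorem theorem3p5 (R : realType) (Omega : set (R * R))
    (f N F : R * R -> 'M[R]_2) (eps : R) (omega : R * R -> R)
    (A1 A2 A3 B1 B2 B3 : R * R -> R)
    (hOmega : is_domain Omega)
    (hf : timelike_immersion Omega f)
    (hnull : null_coordinates Omega f eps omega)
    (hN : unit_normal Omega f N)
    (hF : adapted_frame Omega f N eps omega F)
    (hA : forall p, Omega p ->
       invmx (F p) *m dx F p = A1 p *: xi1 + A2 p *: xi2 + A3 p *: e3)
    (hB : forall p, Omega p ->
       invmx (F p) *m dy F p = B1 p *: xi1 + B2 p *: xi2 + B3 p *: e3) :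
  [<-> harmonic_on Omega (gauss_map f N);
       constant_on Omega (mean_curvature f N eps omega);
       forall lambda : R, lambda != 0 ->
         maurer_cartan Omega
           (one_form (U_lambda A1 A2 A3 lambda) (V_lambda B1 B2 B3 lambda))].
Proof.
case: hOmega => oD cD; case: hf => sf imm; case: hnull => _ so _.
case: hF => sF detF [eps1 [eps2 [/sign_sqr s1 /sign_sqr s2 epsE frame]]].
have domega p : Omega p -> differentiable omega p by exact: (so [::]).
have detf p : Omega p -> \det (f p) = 1.
  by move=> /imm[+ _ _]; rewrite /H31 /= gl_inner_self => /oppr_inj.
have Fx p : Omega p -> dx F p = F p *m sl2 (A1 p) (A2 p) (A3 p).
  by move=> Dp; apply: mulmx_invl (detF p Dp) (hA p Dp).
have Fy p : Omega p -> dy F p = F p *m sl2 (B1 p) (B2 p) (B3 p).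
  by move=> Dp; apply: mulmx_invl (detF p Dp) (hB p Dp).
have fx p : Omega p -> dx f p =
    f p *m (F p *m sl2 (eps1 * expR (omega p * 2^-1)) 0 0 *m bar (F p)).
  move=> Dp; have [E _ _] := frame p Dp; apply: mulmx_invl (detf p Dp) _.
  rewrite E /Ad invmx_det1; last exact: detF.
  by rewrite /sl2 !scale0r !addr0 -scalemxAr -scalemxAl.
have fy p : Omega p -> dy f p =
    f p *m (F p *m sl2 0 (eps2 * expR (omega p * 2^-1)) 0 *m bar (F p)).
  move=> Dp; have [_ E _] := frame p Dp; apply: mulmx_invl (detf p Dp) _.
  rewrite E /Ad invmx_det1; last exact: detF.
  by rewrite /sl2 !scale0r add0r addr0 -scalemxAr -scalemxAl.
have NE p : Omega p -> N p = f p *m (F p *m e3 *m bar (F p)).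
  by move=> Dp; have [_ _ ->] := frame p Dp; rewrite /Ad invmx_det1//; exact: detF.
have nuE p : Omega p -> gauss_map f N p = F p *m e3 *m bar (F p).
  move=> Dp; rewrite /gauss_map NE// invmx_det1; last exact: detf.
  by rewrite (mulmxA (bar (f p))) bar_mulmx detf// mul1mx.
pose a p := dy A1 p + 2 * (A1 p * B3 p).
pose b p := dx B2 p - 2 * (A3 p * B2 p).
(* [frame_gauss_harmonic] has A2_y - 2 A2 B3 in place of [b]; the second structure equation says
   that the two coincide. *)
have harmonicE p : Omega p ->
    lie (gauss_map f N p) (dy (dx (gauss_map f N)) p) = 0 <->
    a p = 0 /\ b p = 0.
  move=> Dp.
  have -> : dy (dx (gauss_map f N)) p =
      dy (dx (fun q => F q *m e3 *m bar (F q))) p.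
    by apply: (eq_derive_on _ oD Dp) => q Dq; exact: (eq_derive_on _ oD Dq nuE).
  rewrite nuE//; apply: (iff_trans (frame_gauss_harmonic oD sF detF Fx Fy Dp)).
  have [_ E _] := frame_structure oD sF detF Fx Fy Dp.
  by rewrite /a /b; split=> -[? ?]; split; lra.
have dH := is_derive_mean_curvature oD sf sF domega s1 s2 epsE detf detF
  Fx Fy fx fy NE.
have mc lambda p v w :=
  @loop_maurer_cartan _ _ _ _ _ _ _ _ _ oD sF detF Fx Fy lambda p v w.
have sign_eq0 (e x : R) : e * e = 1 -> e * x = 0 -> x = 0.
  by move=> ee ex; rewrite -[x]mul1r -ee -mulrA ex mulr0.
tfae.
- move=> harm; apply: connected_constant => // p v Dp.
  have /(harmonicE p Dp)[pa pb] := harm p Dp.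
  apply: is_derive_eq (dH p v Dp) _.
  by rewrite -/(a p) -/(b p) pa pb !mulr0 subr0 mulr0.
- move=> [c Hc] lambda l0 p v w Dp; rewrite mc// -/(a p) -/(b p).
  have H0 u : 'D_u (mean_curvature f N eps omega) p = 0.
    rewrite (eq_derive_on _ oD Dp Hc); exact: derive_cst.
  have m0 : 2 * expR (omega p * - 2^-1) != 0.
    by rewrite mulf_neq0// gt_eqF// expR_gt0.
  (* In the derivative of H, the direction (0,1) isolates [a] and the direction (1,0) isolates [b],
     each up to a sign and a positive factor. *)
  have pa : a p = 0.
    have [_] := dH p (0, 1) Dp; rewrite H0 /= => /esym/eqP.
    rewrite mulf_eq0 (negPf m0) /= mulr0 mul0r subr0 mulr1 => /eqP.
    exact: sign_eq0.
  have pb : b p = 0.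
    have [_] := dH p (1, 0) Dp; rewrite H0 /= => /esym/eqP.
    rewrite mulf_eq0 (negPf m0) /= mulr0 mul0r sub0r mulr1 oppr_eq0 => /eqP.
    exact: sign_eq0.
  by rewrite pa pb !mulr0 (sl2_eq0 0 0 0).2// scaler0.
(* a single value of lambda other than 1 is enough *)
- move=> MC p Dp; apply/(harmonicE p Dp).
  have l0 : (-1 : R) != 0 by rewrite oppr_eq0 oner_eq0.
  have := MC _ l0 p (1, 0) (0, 1) Dp.
  (* At lambda = -1 the factors of [a] and [b] are 2 and -2, and the coordinate vectors make the
     area factor 1. *)
  rewrite mc// -/(a p) -/(b p) /= mulr1 mulr0 subr0 scale1r invrN1.
  by move/sl2_eq0 => [? ? _]; split; lra.
Qed.
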